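(* Let $n>m\geq 1$ be integers with $\gcd(n,m)=1$. Let $\Omega_n$ be the stability region, $\Pi_n$ the projection, and $\Gamma_0,\Gamma_1,\Delta_0,\Delta_1$ and $\omega(\cdot,\cdot)$ the sets and the function defined in the context. Every element of $\Omega_n$ can be parametrized in the form $$[1: x e^{\mathrm{i} t} e^{-\mathrm{i}(n-m)s} : y e^{-\mathrm{i} n s}],$$ with $[1:x:y]\in \Pi_n(\Omega_n)$, $0\leq s\leq 2\pi$, and $t$ a real number satisfying (1) $|t|\leq \frac{\pi}{n}$ if $[1:x:y]\in \Gamma_{n \bmod 2}$, (2) $|t|<\frac{\pi(2\omega-n+1)}{n}$ with $\omega=\omega(x,y)$, if $[1:x:y]\in \Delta_{n\bmod 2}$. Conversely, every point of this form (with $[1:x:y]\in\Pi_n(\Omega_n)$, $0\le s\le 2\pi$ and $t$ real satisfying (1) and (2)) belongs to $\Omega_n$.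
   Context: A polynomial is Schur stable if all its complex roots have modulus strictly less than $1$. $\mathbb{P}^2_{\mathbb{K}}$ is the projective plane over $\mathbb{K}\in\{\mathbb{R},\mathbb{C}\}$, with points $[a:b:c]$. The stability region is $$\Omega_n=\{[1:b:c]\in\mathbb{P}^2_{\mathbb{C}}: \zeta^n+b\zeta^m+c \text{ is a Schur stable trinomial}\}$$ (it depends on the fixed $n>m$; $b,c$ may be zero). The projection $\Pi_n:\Omega_n\to\mathbb{P}^2_{\mathbb{R}}$ is $\Pi_n([1:b:c])=[1:|b|:(-1)^n|c|]$. Set $$\omega(u,v)=\frac{n\arccos\left(\frac{u^2+v^2-1}{2u|v|}\right)+m\arccos\left(\frac{1-u^2+v^2}{2|v|}\right)}{2\pi}$$ and $$\Gamma_0=\{[1:u:v]\in\mathbb{P}^2_{\mathbb{R}}: 0\le u,\ 0\le v,\ u+v<1\},$$ $$\Delta_0=\{[1:u:v]\in\mathbb{P}^2_{\mathbb{R}}: 0<u,\ 0<v,\ u+v\ge 1,\ 2\omega(u,v)>n-1\},$$ $$\Gamma_1=\{[1:u:v]\in\mathbb{P}^2_{\mathbb{R}}: 0\le u,\ v\le 0,\ u-v<1\},$$ $$\Delta_1=\{[1:u:v]\in\mathbb{P}^2_{\mathbb{R}}: 0<u,\ v<0,\ u-v\ge 1,\ 2\omega(u,v)>n-1\},$$ where the condition $2\omega(u,v)>n-1$ is understood to include that the arguments of both $\arccos$ lie in $[-1,1]$. The set $\Pi_n(\Omega_n)$ is the disjoint union of $\Gamma_{n\bmod 2}$ and $\Delta_{n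 \bmod 2}$, so exactly one of (1), (2) applies to each $[1:x:y]\in\Pi_n(\Omega_n)$. *)

(* Defs.v *)
From HB Require Import structures.
From mathcomp Require Import all_boot all_order all_algebra.
From mathcomp Require Import complex.
From mathcomp Require Import all_classical all_reals all_analysis.

Set Implicit Arguments.
Unset Strict Implicit.
Unset Printing Implicit Defensive.

Import Order.TTheory GRing.Theory Num.Theory.

Local Open Scope classical_set_scope.
Local Open Scope complex_scope.
Local Open Scope ring_scope.

Section ProjectivePlane.
Variable K : fieldType.

(* Points are the lines through the origin of K^3. *)
Definition proj_plane := {L : {vspace 'rV[K]_3} | \dim L == 1%N}.

Definition triple (a b c : K) : 'rV[K]_3 := \row_(j < 3) [:: a; b; c]`_j.

Definition hpoint (v : 'rV[K]_3) (v0 : v != 0) : proj_plane :=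
  exist (fun L : {vspace 'rV[K]_3} => \dim L == 1%N) <[v]>%VS
    (introT eqP (etrans (dim_vline v) (congr1 nat_of_bool v0))).

Lemma triple1_neq0 (b c : K) : triple 1 b c != 0.
Proof.
apply/eqP => /rowP/(_ ord0); rewrite !mxE /= => /eqP.
by rewrite oner_eq0.
Qed.

(* [1 : b : c] *)
Definition point1 (b c : K) : proj_plane := hpoint (triple1_neq0 b c).

(* The i-th affine coordinate x_i / x_0 of [x_0 : x_1 : x_2]; it does not depend
   on the representative, and is the junk value 0 on the line x_0 = 0. *)
Definition affine_coord (i : 'I_3) (P : proj_plane) : K :=
  let v := vpick (sval P) in v ord0 i / v ord0 ord0.

Lemma affine_coord_point1 (i : 'I_3) (b c : K) :
  affine_coord i (point1 b c) = triple 1 b c ord0 i.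
Proof.
rewrite /affine_coord /=.
have /vlineP[k kE] := memv_pick <[triple 1 b c]>%VS.
have k0 : k != 0.
  apply/eqP => k0; move: kE; rewrite k0 scale0r => /eqP; rewrite vpick0 => /eqP V0.
  have := memv_line (triple 1 b c).
  by rewrite V0 memv0 (negPf (triple1_neq0 b c)).
by rewrite kE !mxE /= mulr1 mulrAC mulfV // mul1r.
Qed.

Lemma point1_inj (b c b' c' : K) :
  point1 b c = point1 b' c' -> b = b' /\ c = c'.
Proof.
move=> e; split.
  have := congr1 (affine_coord (@Ordinal 3 1 isT)) e.
  by rewrite !affine_coord_point1 !mxE.
have := congr1 (affine_coord (@Ordinal 3 2 isT)) e.
by rewrite !affine_coord_point1 !mxE.
Qed.

End ProjectivePlane.

Section StabilityRegion.
Variable R : realType.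
Implicit Types (n m : nat) (u v x y s t : R).

Definition schur_stable (p : {poly R[i]}) : Prop :=
  forall z : R[i], root p z -> ComplexField.Normc.normc z < 1.

Definition trinomial n m (b c : R[i]) : {poly R[i]} :=
  'X^n + b *: 'X^m + c%:P.

Definition Omega n m : set (proj_plane R[i]) :=
  [set P | exists b c : R[i],
     P = point1 b c /\ schur_stable (trinomial n m b c)].

(* The projection is only meant on Omega, whose points all have x_0 != 0;
   see Pi_map_point1. *)
Definition Pi_map n (P : proj_plane R[i]) : proj_plane R :=
  point1 (ComplexField.Normc.normc (affine_coord (@Ordinal 3 1 isT) P))
         ((-1) ^+ n *
          ComplexField.Normc.normc (affine_coord (@Ordinal 3 2 isT) P)).

Lemma Pi_map_point1 n (b c : R[i]) :
  Pi_map n (point1 b c) =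
  point1 (ComplexField.Normc.normc b)
         ((-1) ^+ n * ComplexField.Normc.normc c).
Proof. by rewrite /Pi_map !affine_coord_point1 !mxE. Qed.

Definition acos_arg1 u v : R := (u ^+ 2 + v ^+ 2 - 1) / (2 * u * `|v|).
Definition acos_arg2 u v : R := (1 - u ^+ 2 + v ^+ 2) / (2 * `|v|).

Definition omega n m u v : R :=
  (n%:R * acos (acos_arg1 u v) + m%:R * acos (acos_arg2 u v)) / (2 * pi).

(* 2 omega(u, v) > n - 1, including that omega(u, v) is well defined: [acos] is
   total in the library, with unspecified values outside [-1, 1]. *)
Definition omega_cond n m u v : Prop :=
  [/\ -1 <= acos_arg1 u v <= 1,
      -1 <= acos_arg2 u v <= 1
    & n%:R - 1 < 2 * omega n m u v].

Definition Gamma0 : set (proj_plane R) :=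
  [set P | exists u v, P = point1 u v /\ [/\ 0 <= u, 0 <= v & u + v < 1]].

Definition Delta0 n m : set (proj_plane R) :=
  [set P | exists u v, P = point1 u v /\
     [/\ 0 < u, 0 < v, 1 <= u + v & omega_cond n m u v]].

Definition Gamma1 : set (proj_plane R) :=
  [set P | exists u v, P = point1 u v /\ [/\ 0 <= u, v <= 0 & u - v < 1]].

Definition Delta1 n m : set (proj_plane R) :=
  [set P | exists u v, P = point1 u v /\
     [/\ 0 < u, v < 0, 1 <= u - v & omega_cond n m u v]].

(* Gamma_(n mod 2) and Delta_(n mod 2) *)
Definition Gamma_parity n : set (proj_plane R) :=
  if odd n then Gamma1 else Gamma0.

Definition Delta_parity n m : set (proj_plane R) :=
  if odd n then Delta1 n m else Delta0 n m.

Definition expi t : R[i] := cos t +i* sin t.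

Definition param_point n m x y s t : proj_plane R[i] :=
  point1 (x%:C * expi t * expi (- ((n%:R - m%:R) * s)))
         (y%:C * expi (- (n%:R * s))).

Definition admissible n m x y s t : Prop :=
  [/\ (Pi_map n @` Omega n m) (point1 x y),
      0 <= s <= 2 * pi,
      Gamma_parity n (point1 x y) -> `|t| <= pi / n%:R
    & Delta_parity n m (point1 x y) ->
        `|t| < pi * (2 * omega n m x y - n%:R + 1) / n%:R].

End StabilityRegion.

Arguments Gamma0 {R}.
Arguments Gamma1 {R}.
Arguments Gamma_parity {R} n.
Arguments Delta0 {R} n m.
Arguments Delta1 {R} n m.
Arguments Delta_parity {R} n m.
Arguments Omega {R} n m.

(* Main.v *)
Require Import Defs.
From mathcomp Require Import all_boot all_order all_algebra.
From mathcomp Require Import complex.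
From mathcomp Require Import all_classical all_reals all_analysis.
From mathcomp Require Import ring lra.

(** Rotating the variable and the coefficients, one may assume that the trinomial is
    [z^n + x e^(it) z^m + (-1)^n r] with [x, r >= 0]; as [n] and [m] are coprime,
    the rotation can be chosen with [|t| <= pi / n] ([rotate_stableE],
    [normalise]). If [x + r < 1] the trinomial is clearly stable. Otherwise the
    question is whether a root of modulus [rho >= 1] exists.

    At a point of modulus [rho] the three terms of the trinomial have moduli
    [rho^n], [x rho^m] and [r]. They can add up to zero only if these are the sides
    of a triangle, and then the directions of the terms are prescribed by its angles.
    Let [A] and [B] be the angles facing [rho^n] and [x rho^m]. Since
    [gcd(n, m) = 1], a common argument of [z] realising the prescribed directions of
    [z^n] and [z^m] exists exactly when [F(rho) = n A + m B] satisfies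
    [cos F(rho) = (-1)^(n+1) cos (n t)] ([cos_angle_sum_of_root],
    [normal_root_exists]). Moreover [F(1) = 2 pi omega].

    As [rho] grows from 1, the function [F] ends at [n pi], where the side [rho^n]
    becomes as long as the two others together, and takes every value in between
    ([angle_sum_surjective]). The value [(n-1) pi + n |t|] satisfies the root
    condition and is at most [n pi]; so a stable trinomial has
    [F(1) > (n-1) pi + n |t|], which is the bound on [t]
    ([angle_sum_gt_of_stable]) and implies the conditions defining [Delta]
    ([triangle_at1_of_gt]).

    Conversely, the derivative of [F] is a quadratic form that the triangle
    inequalities make nonnegative, so [F] is nondecreasing as long as the triangle
    exists, and under the bound on [t] the triangle exists at every radius between 1
    and the modulus of a root ([angle_sum_le]). So a root of modulus at least 1 would
    give a solution of the root condition between [F(1)] and [n pi]. There is none,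
    because [cos] is injective on the interval from [(n-1) pi] to [n pi]
    ([stable_of_angle_sum_gt]). *)

Set Implicit Arguments.
Unset Strict Implicit.
Unset Printing Implicit Defensive.

Import Order.TTheory GRing.Theory Num.Theory.
Import numFieldNormedType.Exports.
Local Open Scope classical_set_scope.
Local Open Scope complex_scope.
Local Open Scope ring_scope.

(** * The arccosine extended to the real line *)

Section ClampedArccos.
Variable R : realType.
Implicit Types (x a b c : R).

Definition clamp x : R := Order.max (-1) (Order.min 1 x).

Lemma clamp_itv x : -1 <= clamp x <= 1.
Proof.
by rewrite /clamp le_max lexx /= ge_max ge_min lexx /= andbT; lra.
Qed.

Lemma clamp_id x : -1 <= x <= 1 -> clamp x = x.
Proof.
by move=> /andP[x1 x2]; rewrite /clamp (min_idPr x2); apply/max_idPr.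
Qed.

Lemma clamp_ge1 x : 1 <= x -> clamp x = 1.
Proof.
by move=> x1; rewrite /clamp (min_idPl x1); apply/max_idPr; lra.
Qed.

Lemma clamp_leN1 x : x <= -1 -> clamp x = -1.
Proof.
move=> x1; have x2 : x <= 1 by lra.
by rewrite /clamp (min_idPr x2); apply/max_idPl.
Qed.

Lemma clamp_continuous : continuous clamp.
Proof.
move=> x.
have minC : {for x, continuous (cst 1 \min id : R -> R^o)}.
  by apply: continuous_min; [exact: cvg_cst|exact: cvg_id].
have : {for x, continuous (cst (-1) \max (cst 1 \min id) : R -> R^o)}.
  by apply: continuous_max; first exact: cvg_cst.
by [].
Qed.

(** Composing with [clamp] makes the arccosine total and continuous: once a triangle
    inequality fails, the angles it computes stay frozen at 0 or [pi]. *)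
Definition clamped_acos x : R := acos (clamp x).

(** On the closed interval the arccosine is the inverse of a continuous bijection of
    a segment. *)
Lemma continuous_acos_itvcc : {within `[(-1 : R), 1], continuous acos}.
Proof.
rewrite -[X in `[X, _]]cospi -[X in `[_, X]]cos0.
apply: segment_can_ge_continuous (@cosK R); first exact: pi_ge0.
by apply: continuous_subspaceT => x; exact: continuous_cos.
Qed.

Lemma clamped_acos_continuous : continuous clamped_acos.
Proof.
move=> x; apply: (@cvg_comp _ _ _ clamp acos _
  (within `[(-1 : R), 1] (nbhs (clamp x)))).
  move=> P; rewrite /within/= => nP.
  have : nbhs x (clamp @^-1` [set y | `[(-1 : R), 1]%classic y -> P y]).
    exact: clamp_continuous nP.
  by apply: filterS => y /=; rewrite in_itv/= clamp_itv; apply.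
have /subspace_continuousP cont := continuous_acos_itvcc.
by apply: cont; rewrite /= in_itv/=; exact: clamp_itv.
Qed.

End ClampedArccos.

(** * Angles of a triangle given by its sides *)

Section TriangleAngles.
Variable R : realType.
Implicit Types (a b c p q r : R).

(** Cosine of the angle facing the side [a] of a triangle of sides [a], [b], [c]. *)
Definition cos_law a b c : R := (b ^+ 2 + c ^+ 2 - a ^+ 2) / (2 * b * c).

Definition angle a b c : R := clamped_acos (cos_law a b c).

Definition triangle a b c : Prop := [/\ a <= b + c, b <= a + c & c <= a + b].

(** This and the next identity factor the distance of the cosine to -1 and 1, which
    turns bounds on the cosine into triangle inequalities. *)
Lemma cos_lawD1 a b c : 0 < b -> 0 < c ->
  cos_law a b c + 1 = ((b + c) ^+ 2 - a ^+ 2) / (2 * b * c).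
Proof. by move=> b0 c0; rewrite /cos_law; field; rewrite !gt_eqF. Qed.

Lemma cos_lawB1 a b c : 0 < b -> 0 < c ->
  1 - cos_law a b c = (a ^+ 2 - (b - c) ^+ 2) / (2 * b * c).
Proof. by move=> b0 c0; rewrite /cos_law; field; rewrite !gt_eqF. Qed.

Lemma cos_law_geN1 a b c : 0 < a -> 0 < b -> 0 < c ->
  (-1 <= cos_law a b c) = (a <= b + c).
Proof.
move=> a0 b0 c0; rewrite -[LHS]subr_ge0 opprK cos_lawD1//.
rewrite pmulr_lge0 ?invr_gt0 ?mulr_gt0// subr_ge0.
by rewrite ler_sqr// ?nnegrE ?normr_ge0//; lra.
Qed.

Lemma cos_law_leN1 a b c : 0 < a -> 0 < b -> 0 < c ->
  (cos_law a b c <= -1) = (b + c <= a).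
Proof.
move=> a0 b0 c0; rewrite -[LHS]subr_le0 opprK cos_lawD1//.
rewrite pmulr_lle0 ?invr_gt0 ?mulr_gt0// subr_le0.
by rewrite ler_sqr// ?nnegrE ?normr_ge0//; lra.
Qed.

Lemma cos_law_le1 a b c : 0 < a -> 0 < b -> 0 < c ->
  (cos_law a b c <= 1) = (`|b - c| <= a).
Proof.
move=> a0 b0 c0; rewrite -[LHS]subr_ge0 cos_lawB1//.
rewrite pmulr_lge0 ?invr_gt0 ?mulr_gt0// subr_ge0 -[(b - c) ^+ 2]real_normK ?num_real//.
by rewrite ler_sqr// ?nnegrE ?normr_ge0//; lra.
Qed.

Lemma cos_law_ge1 a b c : 0 < a -> 0 < b -> 0 < c ->
  (1 <= cos_law a b c) = (a <= `|b - c|).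
Proof.
move=> a0 b0 c0; rewrite -[LHS]subr_le0 cos_lawB1//.
rewrite pmulr_lle0 ?invr_gt0 ?mulr_gt0// subr_le0 -[(b - c) ^+ 2]real_normK ?num_real//.
by rewrite ler_sqr// ?nnegrE ?normr_ge0//; lra.
Qed.

Lemma cos_law_itv a b c : 0 < a -> 0 < b -> 0 < c ->
  -1 <= cos_law a b c <= 1 <-> triangle a b c.
Proof.
move=> a0 b0 c0; rewrite cos_law_geN1// cos_law_le1// ler_norml.
by split=> [/andP[? /andP[? ?]]|[? ? ?]]; [split; lra|apply/and3P; split; lra].
Qed.

Lemma angle_ge0 a b c : 0 <= angle a b c.
Proof. exact/acos_ge0/clamp_itv. Qed.

Lemma angle_lepi a b c : angle a b c <= pi.
Proof. exact/acos_lepi/clamp_itv. Qed.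

Lemma angle_pi a b c : 0 < a -> 0 < b -> 0 < c -> b + c <= a -> angle a b c = pi.
Proof.
move=> a0 b0 c0; rewrite -cos_law_leN1// => h.
by rewrite /angle /clamped_acos clamp_leN1// acosN1.
Qed.

Lemma angle_0 a b c : 0 < a -> 0 < b -> 0 < c -> a <= `|b - c| -> angle a b c = 0.
Proof.
move=> a0 b0 c0; rewrite -cos_law_ge1// => h.
by rewrite /angle /clamped_acos clamp_ge1// acos1.
Qed.

Lemma angleE a b c : 0 < a -> 0 < b -> 0 < c -> triangle a b c ->
  angle a b c = acos (cos_law a b c).
Proof.
by move=> a0 b0 c0 /cos_law_itv h; rewrite /angle /clamped_acos clamp_id// h.
Qed.

Lemma cos_angle a b c : 0 < a -> 0 < b -> 0 < c -> triangle a b c ->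
  cos (angle a b c) = cos_law a b c.
Proof.
move=> a0 b0 c0 abc; rewrite angleE// acosK// in_itv/=.
exact/cos_law_itv.
Qed.

(** Sixteen times the squared area of the triangle, by Heron's formula. *)
Definition heron a b c : R := 4 * b ^+ 2 * c ^+ 2 - (b ^+ 2 + c ^+ 2 - a ^+ 2) ^+ 2.

Lemma heronC a b c : heron a b c = heron b a c.
Proof. by rewrite /heron; ring. Qed.

Lemma heron_gt0 a b c : a < b + c -> b < a + c -> c < a + b -> 0 < heron a b c.
Proof.
move=> h1 h2 h3.
have -> : heron a b c = (a + b + c) * (b + c - a) * (a + c - b) * (a + b - c).
  by rewrite /heron; ring.
by rewrite !mulr_gt0//; lra.
Qed.

Lemma sin_angle a b c : 0 < a -> 0 < b -> 0 < c -> triangle a b c ->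
  sin (angle a b c) = Num.sqrt (heron a b c) / (2 * b * c).
Proof.
move=> a0 b0 c0 abc.
have bc0 : 0 < 2 * b * c by rewrite !mulr_gt0.
rewrite angleE// sin_acos; last exact/cos_law_itv.
rewrite -[X in _ / X]ger0_norm ?ltW// -sqrtr_sqr -sqrtrV ?sqr_ge0//.
rewrite mulrC -sqrtrM ?invr_ge0 ?sqr_ge0//; congr Num.sqrt.
by rewrite /heron /cos_law; field; rewrite !gt_eqF.
Qed.

(** Two angles of a triangle: [cos A + cos B] factors as a product of
    nonnegative terms, so [cos B >= cos (pi - A)]. *)
Lemma angleD_le_pi (p q r : R) : 0 < p -> 0 < q -> 0 < r -> triangle p q r ->
  angle p q r + angle q p r <= pi.
Proof.
move=> p0 q0 r0 pqr.
have qpr : triangle q p r by case: pqr => *; split; lra.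
rewrite -lerBrDr.
have [a0 api] := (angle_ge0 p q r, angle_lepi p q r).
have [b0 bpi] := (angle_ge0 q p r, angle_lepi q p r).
rewrite leNgt -ltr_cos ?in_itv/=; [|by apply/andP; split; lra..].
rewrite -leNgt [pi - _]addrC cosDpi cosN !cos_angle// -subr_ge0 opprK.
have -> : cos_law p q r + cos_law q p r =
    (p + q) * ((r - (p - q)) * (r + (p - q))) / (2 * p * q * r).
  by rewrite /cos_law; field; rewrite !gt_eqF.
by case: pqr => ? ? ?; rewrite divr_ge0 ?mulr_ge0 ?(ltW p0) ?(ltW q0) ?(ltW r0)//; lra.
Qed.

End TriangleAngles.

Section AngleCalculus.
Variable R : realType.
Implicit Types (p q r x s rho : R).

Lemma continuous_angle (a b : R -> R) (c s : R) : b s != 0 -> c != 0 ->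
  {for s, continuous a} -> {for s, continuous b} ->
  {for s, continuous (fun y => angle (a y) (b y) c)}.
Proof.
move=> b0 c0 ca cb; rewrite /angle.
apply: (@continuous_comp _ _ _ (fun y => cos_law (a y) (b y) c)); last first.
  exact: clamped_acos_continuous.
apply: cvgM.
  apply: cvgB; last by rewrite expr2; apply: cvgM.
  by apply: cvgD; [rewrite expr2; apply: cvgM|exact: cvg_cst].
apply: cvgV; first by rewrite !mulf_neq0.
by apply: cvgM; [apply: cvgM => //; exact: cvg_cst|exact: cvg_cst].
Qed.

Lemma is_derive_clamped_acos x : -1 < x < 1 ->
  is_derive x 1 (@clamped_acos R) (- (Num.sqrt (1 - x ^+ 2))^-1).
Proof.
move=> x1; apply: near_eq_is_derive (is_derive1_acos x1).
have : \forall y \near x, y \in `]-1, 1[%R.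
  by apply: near_in_itvoo; rewrite in_itv.
apply: filterS => y; rewrite in_itv/= => /andP[y1 y2].
by rewrite /clamped_acos clamp_id// !ltW.
Qed.

(** The law of cosines is differentiated with the third side fixed; the square root
    in the derivative of the arccosine is [sin], that is, twice the area over the
    product of the adjacent sides. *)
Lemma is_derive_angle (a b : R -> R) (c s da db : R) :
  0 < a s -> 0 < b s -> 0 < c ->
  a s < b s + c -> b s < a s + c -> c < a s + b s ->
  is_derive s 1 a da -> is_derive s 1 b db ->
  is_derive s 1 (fun y => angle (a y) (b y) c)
    ((2 * a s * b s * da - db * (a s ^+ 2 + b s ^+ 2 - c ^+ 2)) /
     (b s * Num.sqrt (heron (a s) (b s) c))).
Proof.
move=> a0 b0 c0 h1 h2 h3 Da Db.
have H0 := heron_gt0 h1 h2 h3.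
have S0 : 0 < Num.sqrt (heron (a s) (b s) c) by rewrite sqrtr_gt0.
have bc0 : 2 * b s * c != 0 by rewrite !mulf_neq0// gt_eqF.
have X1 : -1 < cos_law (a s) (b s) c < 1.
  rewrite !ltNge cos_law_leN1// cos_law_ge1// -!ltNge h1/=.
  by rewrite ltr_norml; apply/andP; split; lra.
have DX : is_derive s 1 (fun y => cos_law (a y) (b y) c)
    ((db * (a s ^+ 2 + b s ^+ 2 - c ^+ 2) - 2 * a s * b s * da)
      / (2 * b s ^+ 2 * c)).
  have DN : is_derive s 1 (fun y => b y ^+ 2 + c ^+ 2 - a y ^+ 2)
     (2 * b s * db - 2 * a s * da).
    apply: is_derive_eq; rewrite /GRing.scale/=; ring.
  have DD : is_derive s 1 (fun y => 2 * b y * c) (2 * db * c).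
    apply: is_derive_eq; rewrite /GRing.scale/=; ring.
  have DI := @is_deriveV _ (fun y => 2 * b y * c) s _ _ bc0 DD.
  have DQ := is_deriveM DN DI.
  apply: is_derive_eq DQ _; rewrite /GRing.scale/=.
  by field; rewrite !gt_eqF.
have := @is_derive1_comp _ _ (fun y => cos_law (a y) (b y) c) s _ _
  (is_derive_clamped_acos X1) DX.
move/is_derive_eq; apply.
have -> : Num.sqrt (1 - cos_law (a s) (b s) c ^+ 2)
   = Num.sqrt (heron (a s) (b s) c) / (2 * b s * c).
  have abc : triangle (a s) (b s) c by split; apply: ltW.
  by rewrite -sin_angle// angleE// sin_acos//; exact/cos_law_itv.
by field; rewrite !gt_eqF.
Qed.

End AngleCalculus.

(** * The angle sum along a family of triangles *)

Lemma IVT_le (R : realType) (f : R -> R) (a b v : R) :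
  a <= b -> {in `[a, b]%R, continuous f} ->
  f a <= v <= f b -> exists2 c : R, a <= c <= b & f c = v.
Proof.
move=> ab cf fv.
have : Num.min (f a) (f b) <= v <= Num.max (f a) (f b).
  by case/andP: fv => h1 h2; rewrite ge_min h1/= le_max h2 orbT.
move/(IVT ab) => [|c]; last by rewrite in_itv/=; exists c.
by apply: continuous_in_subspaceT => y; rewrite inE/= => /cf.
Qed.

Section AngleSum.
Variables (R : realType) (n m : nat) (x r : R).
Implicit Types (rho b c v : R).

(** The sides of the triangle are the moduli of the three terms of the trinomial at a
    point of modulus [rho]. At [rho = 1] the value is [2 * pi * omega]. *)
Definition angle_sum rho : R :=
  n%:R * angle (rho ^+ n) (x * rho ^+ m) r +
  m%:R * angle (x * rho ^+ m) (rho ^+ n) r.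

Definition triangle_at rho := triangle (rho ^+ n) (x * rho ^+ m) r.

Let p_gt0 rho : 0 < rho -> 0 < rho ^+ n. Proof. exact: exprn_gt0. Qed.
Let q_gt0 rho : 0 < x -> 0 < rho -> 0 < x * rho ^+ m.
Proof. by move=> x0 h; rewrite mulr_gt0// exprn_gt0. Qed.

(** The angle facing a side as long as the two others together is [pi] and the other
    two vanish. The clamping extends this to the regions where a triangle inequality
    fails, hence the inequality in the hypothesis here and in the next two lemmas. *)
Lemma angle_sum_first rho : 0 < x -> 0 < r -> 0 < rho -> x * rho ^+ m + r <= rho ^+ n ->
  angle_sum rho = n%:R * pi.
Proof.
move=> x0 r0 h le; have p0 := p_gt0 h; have q0 := q_gt0 x0 h.
rewrite /angle_sum angle_pi// angle_0// ?mulr0 ?addr0//.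
by rewrite ger0_norm; lra.
Qed.

Lemma angle_sum_second rho : 0 < x -> 0 < r -> 0 < rho -> rho ^+ n + r <= x * rho ^+ m ->
  angle_sum rho = m%:R * pi.
Proof.
move=> x0 r0 h le; have p0 := p_gt0 h; have q0 := q_gt0 x0 h.
rewrite /angle_sum addrC angle_pi// angle_0// ?mulr0 ?addr0//.
by rewrite ger0_norm; lra.
Qed.

Lemma angle_sum_third rho : 0 < x -> 0 < r -> 0 < rho -> rho ^+ n + x * rho ^+ m <= r ->
  angle_sum rho = 0.
Proof.
move=> x0 r0 h le; have p0 := p_gt0 h; have q0 := q_gt0 x0 h.
by rewrite /angle_sum !angle_0// ?mulr0 ?addr0// ltr0_norm; lra.
Qed.

Lemma continuous_angle_sum rho : 0 < x -> 0 < r -> 0 < rho ->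
  {for rho, continuous angle_sum}.
Proof.
move=> x0 r0 h.
have cX k : {for rho, continuous (fun y : R => y ^+ k)}.
  exact: exprn_continuous.
have cq : {for rho, continuous (fun y : R => x * y ^+ m)}.
  by apply: cvgM; [exact: cvg_cst|exact: cX].
have p0 : rho ^+ n != 0 by rewrite gt_eqF// p_gt0.
have q0 : x * rho ^+ m != 0 by rewrite gt_eqF// q_gt0.
have r0' : r != 0 by rewrite gt_eqF.
have c1 := @continuous_angle R (fun y => y ^+ n) (fun y => x * y ^+ m) r rho
  q0 r0' (cX n) cq.
have c2 := @continuous_angle R (fun y => x * y ^+ m) (fun y => y ^+ n) r rho
  p0 r0' cq (cX n).
by apply: cvgD; apply: cvgM => //; exact: cvg_cst.
Qed.

(** Differentiating along the family, the contributions of both angles share the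
    same denominator and combine into a quadratic form in the three sides. *)
Lemma is_derive_angle_sum rho : 0 < x -> 0 < r -> 0 < rho ->
  rho ^+ n < x * rho ^+ m + r -> x * rho ^+ m < rho ^+ n + r ->
  r < rho ^+ n + x * rho ^+ m ->
  is_derive rho 1 angle_sum
   (2 * (n%:R ^+ 2 * (rho ^+ n) ^+ 2 + m%:R ^+ 2 * (x * rho ^+ m) ^+ 2
     - n%:R * m%:R * ((rho ^+ n) ^+ 2 + (x * rho ^+ m) ^+ 2 - r ^+ 2)) /
   (rho * Num.sqrt (heron (rho ^+ n) (x * rho ^+ m) r))).
Proof.
move=> x0 r0 h h1 h2 h3; have p0 := p_gt0 h; have q0 := q_gt0 x0 h.
have S0 : 0 < Num.sqrt (heron (rho ^+ n) (x * rho ^+ m) r).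
  by rewrite sqrtr_gt0 heron_gt0.
have DX k : is_derive rho 1 (fun y : R => y ^+ k) (k%:R * rho ^+ k / rho).
  apply: DeriveDef; first exact: exprn_derivable.
  rewrite exp_derive /GRing.scale/= mulr1.
  case: k => [|k]; first by rewrite !mul0r.
  by rewrite exprSr mulrA mulfK// gt_eqF.
have Dq : is_derive rho 1 (fun y : R => x * y ^+ m)
    (m%:R * (x * rho ^+ m) / rho).
  have := DX m => D; apply: is_derive_eq; rewrite /GRing.scale/=; ring.
have h3' : r < x * rho ^+ m + rho ^+ n by rewrite addrC.
have D1 := @is_derive_angle _ (fun y => y ^+ n) (fun y => x * y ^+ m) r rho _ _
  p0 q0 r0 h1 h2 h3 (DX n) Dq.
have D2 := @is_derive_angle _ (fun y => x * y ^+ m) (fun y => y ^+ n) r rho _ _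
  q0 p0 r0 h2 h1 h3' Dq (DX n).
rewrite heronC in D2.
apply: is_derive_eq (is_deriveD (is_deriveZ n%:R D1) (is_deriveZ m%:R D2)) _.
rewrite /GRing.scale/=.
by field; rewrite !gt_eqF// exprn_gt0.
Qed.

Lemma angle_sum_le_pi (rho : R) : 0 < x -> 0 < r -> (m <= n)%N -> 0 < rho ->
  triangle_at rho -> angle_sum rho <= n%:R * pi.
Proof.
move=> x0 r0 mn rho0 tri.
have p0 : 0 < rho ^+ n by rewrite exprn_gt0.
have q0 : 0 < x * rho ^+ m by rewrite mulr_gt0 ?exprn_gt0.
have := ler_wpM2l (ler0n R n) (angleD_le_pi p0 q0 r0 tri).
apply: le_trans; rewrite mulrDr lerD2l ler_wpM2r ?ler_nat//.
exact: angle_ge0.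
Qed.

Lemma triangle_atP rho : 0 < x -> 0 < r -> 0 < rho ->
  [\/ triangle_at rho, rho ^+ n + r <= x * rho ^+ m,
      x * rho ^+ m + r <= rho ^+ n | rho ^+ n + x * rho ^+ m <= r].
Proof.
move=> x0 r0 h; have p0 := p_gt0 h; have q0 := q_gt0 x0 h.
have [h1|h1] := leP (rho ^+ n + r) (x * rho ^+ m); first by apply: Or42.
have [h2|h2] := leP (x * rho ^+ m + r) (rho ^+ n); first by apply: Or43.
have [h3|h3] := leP (rho ^+ n + x * rho ^+ m) r; first by apply: Or44.
by apply: Or41; split; exact: ltW.
Qed.

(** With [p] and [q] the two moving sides, the quadratic form in the derivative is
    [(n p)^2 + (m q)^2 - n m (p^2 + q^2 - r^2)], and [p^2 + q^2 - r^2 <= 2 p q]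
    in a triangle, so it is at least [(n p - m q)^2]. *)
Lemma angle_sum_nondecreasing c : 0 < x -> 0 < r -> 1 <= c ->
  (forall rho, 1 < rho < c -> [/\ rho ^+ n < x * rho ^+ m + r,
     x * rho ^+ m < rho ^+ n + r & r < rho ^+ n + x * rho ^+ m]) ->
  angle_sum 1 <= angle_sum c.
Proof.
move=> x0 r0 c1 strict.
have D rho : rho \in `]1, c[%R -> is_derive rho 1 angle_sum
   (2 * (n%:R ^+ 2 * (rho ^+ n) ^+ 2 + m%:R ^+ 2 * (x * rho ^+ m) ^+ 2
     - n%:R * m%:R * ((rho ^+ n) ^+ 2 + (x * rho ^+ m) ^+ 2 - r ^+ 2)) /
   (rho * Num.sqrt (heron (rho ^+ n) (x * rho ^+ m) r))).
  rewrite in_itv/= => h; have [h1 h2 h3] := strict _ h.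
  by apply: is_derive_angle_sum => //; case/andP: h => h4 h5; lra.
apply: (@ger0_derive1_le_cc _ angle_sum 1 c) => //; rewrite ?in_itv/= ?lexx//.
- by move=> rho /D[].
- move=> rho h; rewrite derive1E; have [_ ->] := D _ h.
  move: h; rewrite in_itv/= => h; have [h1 h2 h3] := strict _ h.
  have rho0 : 0 < rho by case/andP: h => h4 h5; lra.
  rewrite divr_ge0 ?mulr_ge0 ?sqrtr_ge0 ?(ltW rho0)//.
  set p := rho ^+ n in h1 h2 h3 *; set q := x * rho ^+ m in h1 h2 h3 *.
  have le : p ^+ 2 + q ^+ 2 - r ^+ 2 <= 2 * p * q.
    suff : 0 <= (r - (p - q)) * (r + (p - q)) by lra.
    by apply: mulr_ge0; lra.
  have nm : 0 <= n%:R * m%:R :> R by rewrite mulr_ge0.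
  have e1 := ler_wpM2l nm le.
  have e2 := sqr_ge0 (n%:R * p - m%:R * q).
  lra.
- apply: continuous_in_subspaceT => rho; rewrite inE/= in_itv/= => /andP[h _].
  by apply: continuous_angle_sum; lra.
- by rewrite c1.
Qed.

(** The touching radius is the minimum of a nonempty compact set. *)
Lemma first_second_side_touch (b : R) : 1 <= b -> b ^+ n + r <= x * b ^+ m ->
  exists c : R, [/\ 1 <= c <= b, c ^+ n + r <= x * c ^+ m &
    forall rho, 1 <= rho < c -> x * rho ^+ m < rho ^+ n + r].
Proof.
move=> b1 hb.
pose A := `[1, b]%classic `&`
   [set rho : R | rho ^+ n + r - x * rho ^+ m <= 0].
have cA : compact A.
  apply: compact_closedI; first exact: segment_compact.
  apply: (@closed_comp _ _ (fun rho => rho ^+ n + r - x * rho ^+ m) [set y | y <= 0]).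
    move=> y _; apply: cvgB.
      by apply: cvgD; [exact: exprn_continuous|exact: cvg_cst].
    by apply: cvgM; [exact: cvg_cst|exact: exprn_continuous].
  exact: closed_le.
have A0 : A !=set0.
  by exists b; split => /=; [rewrite in_itv/= b1 lexx|lra].
have [|c] := @compact_EVT_min _ _ id A A0 cA.
  by apply: continuous_subspaceT => y; exact: cvg_id.
rewrite inE => -[/=]; rewrite in_itv/= => cb hc minc.
exists c; split => //; first by lra.
move=> rho /andP[rho1 rhoc]; rewrite ltNge; apply/negP => le.
suff : rho \in A by move=> /minc; rewrite leNgt rhoc.
rewrite inE; split => /=; last lra.
by rewrite in_itv/= rho1/=; case/andP: cb => h4 h5; lra.
Qed.

(** Between 1 and [b] only the inequality on the second side can break: [r] is
    overtaken by the growing sides, and the first side minus the second is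
    [rho ^+ m * (rho ^+ (n - m) - x)], increasing once positive. If the second
    side ever became too long, the angle sum would increase up to that radius and
    be equal to [m * pi] there, which is below its starting value. *)
Lemma angle_sum_le (b : R) : (m < n)%N -> 0 < x -> 0 < r ->
  1 <= b -> triangle_at 1 -> triangle_at b ->
  m%:R * pi < angle_sum 1 -> angle_sum 1 <= angle_sum b.
Proof.
move=> m_lt_n x0 r0 b1 [/=]; rewrite !expr1n mulr1 => t1 t2 t3 [s1 s2 s3] big.
have b0 : 0 < b by lra.
have strict c : 1 <= c <= b ->
  (forall rho, 1 <= rho < c -> x * rho ^+ m < rho ^+ n + r) ->
  angle_sum 1 <= angle_sum c.
  move=> /andP[c1 cb] h2; apply: angle_sum_nondecreasing => // rho /andP[rho1 rhoc].
  have rho0 : 0 < rho by lra.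
  have pn : 1 < rho ^+ n by rewrite exprn_egt1// -lt0n (leq_trans _ m_lt_n).
  have pm : 1 <= rho ^+ m by rewrite exprn_ege1// ltW.
  have qm : x <= x * rho ^+ m by rewrite ler_peMr// ltW.
  split; [|by apply: h2; rewrite ltW|lra].
  rewrite ltNge; apply/negP => le.
  have nmE : n = (n - m + m)%N by rewrite subnK// ltnW.
  have pqE y : y ^+ n - x * y ^+ m = y ^+ m * (y ^+ (n - m) - x).
    by rewrite {1}nmE exprD; ring.
  have rhob : rho < b by lra.
  have e1 : rho ^+ m <= b ^+ m by rewrite lerXn2r ?nnegrE ?ltW.
  have e2 : rho ^+ (n - m) < b ^+ (n - m).
    by rewrite ltrXn2r ?subn_eq0 -?ltnNge ?ltW.
  have pos : 0 < rho ^+ (n - m) - x.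
    have : 0 < rho ^+ m * (rho ^+ (n - m) - x).
      by rewrite -pqE subr_gt0 (lt_le_trans _ le)// ltrDl.
    by rewrite pmulr_rgt0// exprn_gt0.
  have : rho ^+ m * (rho ^+ (n - m) - x) < b ^+ m * (b ^+ (n - m) - x).
    apply: (@le_lt_trans _ _ (b ^+ m * (rho ^+ (n - m) - x))).
      by rewrite ler_wpM2r// ltW.
    by rewrite ltr_pM2l ?exprn_gt0// ltrD2r.
  by rewrite -!pqE; lra.
have [h|/existsNP[rho1]] :=
  pselect (forall rho, 1 <= rho < b -> x * rho ^+ m < rho ^+ n + r).
  by apply: strict => //; rewrite b1 lexx.
move/not_implyP => [/andP[h1 h2] /negP]; rewrite -leNgt => h3.
have [c [/andP[c1 cb] hc first]] := first_second_side_touch h1 h3.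
have : angle_sum 1 <= angle_sum c by apply: strict => //; apply/andP; split; lra.
by rewrite (@angle_sum_second c) ?hc//; lra.
Qed.

(** The term of highest degree dominates for large radii. *)
Lemma first_side_degenerates : (m < n)%N -> 0 < x -> 0 < r -> 1 <= x + r ->
  exists2 b : R, 1 <= b & r = b ^+ n - x * b ^+ m.
Proof.
move=> m_lt_n x0 r0 xr.
pose M := 1 + x + r.
have M1 : 1 <= M by rewrite /M; lra.
have M0 : 0 < M by lra.
have hM : x * M ^+ m + r <= M ^+ n.
  apply: (@le_trans _ _ (M ^+ m.+1)); last by rewrite ler_weXn2l.
  have Mm : 1 <= M ^+ m by rewrite exprn_ege1.
  rewrite exprS {2}/M !mulrDl mul1r.
  by have := ler_wpM2l (ltW r0) Mm; lra.
have [||c /andP[c1 _] hc] := @IVT_le R (fun y => y ^+ n - x * y ^+ m) 1 M r M1.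
- move=> y _; apply: cvgB; first exact: exprn_continuous.
  by apply: cvgM; [exact: cvg_cst|exact: exprn_continuous].
- by rewrite !expr1n; apply/andP; split; lra.
by exists c => //; lra.
Qed.

(** The intermediate value theorem applies to the clamped angle sum, whose last value
    is [n * pi]. If the radius it gives violates a triangle inequality, the same
    value is taken again at a larger radius where that inequality is an equality,
    since the clamped angles are constant as long as it fails. *)
Lemma angle_sum_surjective v : (m < n)%N -> 0 < x -> 0 < r -> 1 <= x + r ->
  angle_sum 1 <= v <= n%:R * pi ->
  exists rho : R, [/\ 1 <= rho, triangle_at rho & angle_sum rho = v].
Proof.
move=> m_lt_n x0 r0 xr vv.
have [b b1 hb] := first_side_degenerates m_lt_n x0 r0 xr.
have b0 : 0 < b by lra.
have qb := q_gt0 x0 b0.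
have tb : triangle_at b by split; lra.
have asb : angle_sum b = n%:R * pi by apply: angle_sum_first => //; lra.
have [||c /andP[c1 cb] hc] := @IVT_le R angle_sum 1 b v b1.
- move=> y; rewrite in_itv/= => /andP[y1 _].
  by apply: continuous_angle_sum; lra.
- by rewrite asb.
have c0 : 0 < c by lra.
have cX k : continuous (fun y : R => y ^+ k) by exact: exprn_continuous.
have cq : continuous (fun y : R => x * y ^+ m).
  by move=> y; apply: cvgM; [exact: cvg_cst|exact: cX].
have [tc|h|h|h] := triangle_atP x0 r0 c0.
- by exists c.
- have [||d /andP[d1 _] hd] :=
    @IVT_le R (fun y => y ^+ n + r - x * y ^+ m) c b 0 cb.
  + move=> y _; apply: cvgB; last exact: cq.
    by apply: cvgD; [exact: cX|exact: cvg_cst].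
  + by apply/andP; split; lra.
  have d0 : 0 < d by lra.
  have pd := p_gt0 d0; have qd := q_gt0 x0 d0.
  exists d; split; [lra|by split; lra|].
  by rewrite -hc (angle_sum_second x0 r0 c0 h) angle_sum_second//; lra.
- by exists b; split => //; rewrite asb -hc (angle_sum_first x0 r0 c0 h).
- have [||d /andP[d1 _] hd] :=
    @IVT_le R (fun y => y ^+ n + x * y ^+ m) c b r cb.
  + by move=> y _; apply: cvgD; [exact: cX|exact: cq].
  + by apply/andP; split; lra.
  have d0 : 0 < d by lra.
  have pd := p_gt0 d0; have qd := q_gt0 x0 d0.
  exists d; split; [lra|by split; lra|].
  by rewrite -hc (angle_sum_third x0 r0 c0 h) angle_sum_third//; lra.
Qed.

End AngleSum.

(** * The unit circle *)

Section UnitCircle.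
Variable R : realType.
Implicit Types (s t a : R) (z w : R[i]) (n m : nat).
Local Notation normc := ComplexField.Normc.normc.

Lemma expiD s t : expi (s + t) = expi s * expi t.
Proof.
rewrite /expi cosD sinD; simpc; congr (_ +i* _).
by rewrite addrC [cos s * _]mulrC.
Qed.

Lemma expi0 : expi 0 = 1 :> R[i].
Proof. by rewrite /expi cos0 sin0. Qed.

Lemma expiMn n t : expi (n%:R * t) = expi t ^+ n.
Proof.
elim: n => [|n IH]; first by rewrite mul0r expi0.
by rewrite -natr1 mulrDl mul1r expiD IH exprSr.
Qed.

Lemma normc_expi t : normc (expi t) = 1.
Proof. by rewrite /= cos2Dsin2 sqrtr1. Qed.

Lemma expi_neq0 t : expi t != 0.
Proof.
apply/eqP => h; have := normc_expi t.
by rewrite h ComplexField.Normc.normc0 => /esym/eqP; rewrite oner_eq0.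
Qed.

Lemma expiN t : expi (- t) = (expi t)^-1.
Proof.
by apply: (mulfI (expi_neq0 t)); rewrite -expiD subrr expi0 divff ?expi_neq0.
Qed.

Lemma expi_pi : expi pi = -1 :> R[i].
Proof. by rewrite /expi cospi sinpi; apply/eqP; rewrite eq_complex /= oppr0 !eqxx. Qed.

Lemma expi_natpi n : expi (n%:R * pi) = (-1) ^+ n :> R[i].
Proof. by rewrite expiMn expi_pi. Qed.

Lemma expiD2piz t (k : int) : expi (t + 2 * pi * k%:~R) = expi t.
Proof.
have e2 : expi (2 * pi) = 1 :> R[i] by rewrite expi_natpi expr2 mulN1r opprK.
rewrite expiD; case: (intP k) => [|j|j]; rewrite ?mulr0 ?expi0 ?mulr1//.
  by rewrite mulrC -pmulrn [2 * pi * _]mulrC expiMn e2 expr1n mul1r.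
by rewrite mulrNz mulrN expiN -pmulrn [2 * pi * _]mulrC expiMn e2 expr1n invr1 mulr1.
Qed.

Lemma normc_real a : normc a%:C = `|a|.
Proof. by rewrite /= expr0n/= addr0 sqrtr_sqr. Qed.

Lemma normcX z n : normc (z ^+ n) = normc z ^+ n.
Proof.
elim: n => [|n IH]; first by rewrite !expr0 ComplexField.Normc.normc1.
by rewrite !exprS ComplexField.Normc.normcM IH.
Qed.

Lemma normc_ge0 z : 0 <= normc z.
Proof. by case: z => a b /=; exact: sqrtr_ge0. Qed.

Lemma normc_eq0 z : (normc z == 0) = (z == 0).
Proof.
apply/eqP/eqP => [/ComplexField.Normc.eq0_normc//|->].
exact: ComplexField.Normc.normc0.
Qed.

Lemma sin_of_cos_eq s t : cos s = cos t -> sin s = sin t \/ sin s = - sin t.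
Proof.
move=> h; have /eqP : sin s ^+ 2 = sin t ^+ 2 by rewrite !sin2cos2 h.
by rewrite eqf_sqr => /orP[/eqP ->|/eqP ->]; [left|right].
Qed.

Lemma polar z : exists t, z = (normc z)%:C * expi t.
Proof.
have [->|z0] := eqVneq z 0.
  by exists 0; rewrite ComplexField.Normc.normc0 mul0r.
have r0 : 0 < normc z by rewrite lt_def normc_eq0 z0 normc_ge0.
case: z z0 r0 => a b z0; set r := normc _ => r0.
have rE : r ^+ 2 = a ^+ 2 + b ^+ 2.
  by rewrite /r/= sqr_sqrtr// addr_ge0// sqr_ge0.
have r_neq0 : r != 0 by rewrite gt_eqF.
pose u := acos (a / r).
have ar : -1 <= a / r <= 1.
  rewrite ler_pdivlMr// ler_pdivrMr// mulN1r mul1r -ler_norml.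
  rewrite -(ler_sqr (x := `|a|)) ?nnegrE ?normr_ge0 ?(ltW r0)//.
  by rewrite real_normK ?num_real// rE lerDl sqr_ge0.
have cu : cos u = a / r by rewrite acosK// in_itv.
have /eqP : sin u ^+ 2 = (b / r) ^+ 2.
  rewrite sin2cos2 cu; apply/(mulIf (expf_neq0 2 r_neq0)).
  by rewrite mulrBl !expr_div_n !divfK ?expf_neq0// rE; ring.
rewrite eqf_sqr => /orP[/eqP su|/eqP su].
  exists u; rewrite /expi cu su; simpc; apply/eqP.
  by rewrite eq_complex/= ![r * _]mulrC !divfK// !eqxx.
exists (- u); rewrite /expi cosN sinN cu su opprK; simpc; apply/eqP.
by rewrite eq_complex/= ![r * _]mulrC !divfK// !eqxx.
Qed.

End UnitCircle.

(** With a Bezout relation [a n - b m = 1] the solution is [P^a / Q^b]. *)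
Lemma coprime_power_root (F : fieldType) (P Q : F) n m : (0 < n)%N -> coprime n m ->
  P != 0 -> Q != 0 -> P ^+ m = Q ^+ n ->
  exists w, w ^+ n = P /\ w ^+ m = Q.
Proof.
move=> n0 /eqP cop P0 Q0 PQ.
case: (egcdnP m n0); rewrite cop => a b ab _.
exists (P ^+ a / Q ^+ b).
have Pab : P ^+ (a * n) = P * P ^+ (b * m) by rewrite ab exprD expr1 mulrC.
have Qab : Q ^+ (a * n) = Q * Q ^+ (b * m) by rewrite ab exprD expr1 mulrC.
split; rewrite expr_div_n -!exprM.
  rewrite Pab [(b * n)%N]mulnC [Q ^+ _]exprM -PQ -exprM [(m * b)%N]mulnC.
  by rewrite mulfK ?expf_neq0.
by rewrite [(a * m)%N]mulnC [P ^+ _]exprM PQ -exprM [(n * a)%N]mulnC Qab mulfK ?expf_neq0.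
Qed.

(** * Roots of the normalised trinomial *)

Section Roots.
Variable R : realType.
Implicit Types (x r t rho : R) (z b c : R[i]) (n m : nat).
Local Notation normc := ComplexField.Normc.normc.

(** The law of cosines, read in both directions, determines both angles up to sign;
    the vanishing imaginary part forces opposite signs. The boolean records which
    of the two mirror images of the triangle occurs. *)
Lemma closed_triangle_angles (p q r phi psi : R) : 0 < p -> 0 < q -> 0 < r ->
  p * cos phi + q * cos psi = r -> p * sin phi + q * sin psi = 0 ->
  triangle p q r /\
  exists e : bool, expi phi = expi ((-1) ^+ e * angle q p r) /\
                   expi psi = expi (- ((-1) ^+ e * angle p q r)).
Proof.
move=> p0 q0 r0 hc hs.
have cphi : cos phi = cos_law q p r.
  have e1 : q ^+ 2 = p ^+ 2 + r ^+ 2 - 2 * p * r * cos phi.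
    have -> : q ^+ 2 = (q * cos psi) ^+ 2 + (q * sin psi) ^+ 2.
      by rewrite !exprMn -mulrDr cos2Dsin2 mulr1.
    have -> : q * cos psi = r - p * cos phi by lra.
    have -> : q * sin psi = - (p * sin phi) by lra.
    have -> : p ^+ 2 = (p * cos phi) ^+ 2 + (p * sin phi) ^+ 2.
      by rewrite !exprMn -mulrDr cos2Dsin2 mulr1.
    by ring.
  by rewrite /cos_law e1; field; rewrite !gt_eqF.
have cpsi : cos psi = cos_law p q r.
  have e1 : p ^+ 2 = q ^+ 2 + r ^+ 2 - 2 * q * r * cos psi.
    have -> : p ^+ 2 = (p * cos phi) ^+ 2 + (p * sin phi) ^+ 2.
      by rewrite !exprMn -mulrDr cos2Dsin2 mulr1.
    have -> : p * cos phi = r - q * cos psi by lra.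
    have -> : p * sin phi = - (q * sin psi) by lra.
    have -> : q ^+ 2 = (q * cos psi) ^+ 2 + (q * sin psi) ^+ 2.
      by rewrite !exprMn -mulrDr cos2Dsin2 mulr1.
    by ring.
  by rewrite /cos_law e1; field; rewrite !gt_eqF.
have pqr : triangle p q r.
  by apply/cos_law_itv => //; rewrite -cpsi cos_geN1 cos_le1.
have qpr : triangle q p r by case: pqr => *; split; lra.
split=> //.
rewrite -cos_angle// in cphi; rewrite -cos_angle// in cpsi.
set B := angle q p r in cphi *; set A := angle p q r in cpsi *.
have sAB : p * sin B = q * sin A.
  rewrite !sin_angle// heronC; field.
  by rewrite !gt_eqF.
have [sphi|sphi] := sin_of_cos_eq cphi; [exists false|exists true];
  rewrite /= ?expr0 ?expr1 ?mulN1r ?mul1r ?opprK /expi ?cosN ?sinN cphi cpsi sphi;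
  split => //; congr (_ +i* _); apply: (mulfI (lt0r_neq0 q0)).
  by rewrite mulrN -sAB -sphi; lra.
by rewrite -sAB -[sin B]opprK -sphi; lra.
Qed.

Lemma angles_close_triangle (p q r : R) (e : bool) : 0 < p -> 0 < q -> 0 < r ->
  triangle p q r ->
  p%:C * expi ((-1) ^+ e * angle q p r) +
  q%:C * expi (- ((-1) ^+ e * angle p q r)) = r%:C.
Proof.
move=> p0 q0 r0 pqr.
have qpr : triangle q p r by case: pqr => *; split; lra.
have cc : p * cos (angle q p r) + q * cos (angle p q r) = r.
  by rewrite !cos_angle// /cos_law; field; rewrite !gt_eqF.
have ss : p * sin (angle q p r) = q * sin (angle p q r).
  by rewrite !sin_angle// heronC; field; rewrite !gt_eqF.
apply/eqP; rewrite eq_complex; apply/andP; split; apply/eqP.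
  by case: e; rewrite /expi; simpc; rewrite /= ?expr1 ?expr0 ?mulN1r ?mul1r ?cosN.
case: e; rewrite /expi; simpc;
  rewrite /= ?expr1 ?expr0 ?mulN1r ?mul1r ?opprK ?sinN; lra.
Qed.

Lemma coprime_odd n m : coprime n m -> odd n || odd m.
Proof.
move=> cop; case on : (odd n); case om : (odd m) => //.
have : (2 %| gcdn n m)%N by rewrite dvdn_gcd !dvdn2 on om.
by rewrite (eqP cop).
Qed.

(** If [n] is odd both exponents are even, and if [n] is even then [n - m] is odd. *)
Lemma signr_coprime n m : coprime n m -> (m < n)%N ->
  (-1) ^+ ((n - m) * n.+1) = (-1) ^+ n.+1 :> R.
Proof.
move=> /coprime_odd cop mn.
suff h : odd ((n - m) * n.+1) = odd n.+1 by rewrite -signr_odd h signr_odd.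
rewrite oddM oddB ?(ltnW mn)//=.
by case: (odd n) cop; case: (odd m).
Qed.

(** Roots of the trinomial once a rotation of the variable has made the constant term
    real; its sign [(-1) ^+ n] is the one used by the projection [Pi_map]. *)
Definition normal_root n m x t r z : Prop :=
  z ^+ n + (x%:C * expi t) * z ^+ m + ((-1) ^+ n * r)%:C = 0.

(** The directions of the terms of degree [n] and [m] are the angles [B] and
    [- A] of the triangle, up to a common sign. Eliminating the argument of the
    root from [n th = B] and [m th + t = - A] (up to multiples of [pi]) leaves
    one condition, on [n A + m B] only; the cosine absorbs the common sign and
    the multiples of [2 * pi]. *)
Lemma cos_angle_sum_of_root n m x t r z : coprime n m -> (m < n)%N -> 0 < x -> 0 < r ->
  z != 0 -> normal_root n m x t r z ->
  triangle_at n m x r (normc z) /\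
  cos (angle_sum n m x r (normc z)) = (-1) ^+ n.+1 * cos (n%:R * t).
Proof.
move=> cop mn x0 r0 z0 hz.
have [th zE] := polar z.
set rho := normc z in zE *.
have rho0 : 0 < rho by rewrite lt_def normc_eq0 z0 normc_ge0.
pose phi := n%:R * th + n.+1%:R * pi.
pose psi := t + m%:R * th + n.+1%:R * pi.
have sum : (rho ^+ n)%:C * expi phi + (x * rho ^+ m)%:C * expi psi = r%:C.
  have -> : r%:C = (-1) ^+ n.+1 * - ((-1) ^+ n * r)%:C :> R[i].
    rewrite rmorphM/= rmorphXn/= rmorphN1 exprS mulN1r mulrNN mulrA -exprD addnn.
    by rewrite -mul2n exprM sqrrN !expr1n mul1r.
  have -> : - ((-1) ^+ n * r)%:C = z ^+ n + x%:C * expi t * z ^+ m.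
    by apply/eqP; rewrite eq_sym -subr_eq0 opprK; apply/eqP.
  rewrite zE !exprMn /phi /psi !expiD !expi_natpi !expiMn rmorphM !rmorphXn /=.
  by ring.
have [pqr [e [ephi epsi]]] : triangle (rho ^+ n) (x * rho ^+ m) r /\
    exists e : bool,
      expi phi = expi ((-1) ^+ e * angle (x * rho ^+ m) (rho ^+ n) r) /\
      expi psi = expi (- ((-1) ^+ e * angle (rho ^+ n) (x * rho ^+ m) r)).
  move: sum; rewrite /expi; simpc => /eqP; rewrite eq_complex/= => /andP[/eqP h1 /eqP h2].
  by apply: closed_triangle_angles; rewrite ?mulr_gt0 ?exprn_gt0.
split=> //.
have : expi (n%:R * psi - m%:R * phi) = expi (- ((-1) ^+ e * angle_sum n m x r rho)).
  rewrite expiD expiN !expiMn ephi epsi -!expiMn -expiN -expiD; congr expi.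
  by rewrite /angle_sum; ring.
have -> : n%:R * psi - m%:R * phi = n%:R * t + ((n - m) * n.+1)%:R * pi.
  rewrite [((n - m) * _)%:R]natrM [(n - m)%:R]natrB; last exact: ltnW.
  by rewrite /psi /phi; set N := n.+1%:R; ring.
rewrite expiD expi_natpi => /(congr1 (@complex.Re R)).
have -> : (-1) ^+ ((n - m) * n.+1) = ((-1) ^+ n.+1 : R)%:C :> R[i].
  by rewrite -(signr_coprime cop mn) rmorphXn/= rmorphN1.
rewrite /expi; simpc => /=.
rewrite cosN; case: e {ephi epsi}; rewrite /= ?expr1 ?expr0 ?mulN1r ?mul1r ?cosN => <-;
  by rewrite mulrC.
Qed.

(** Converse of the elimination: the condition on the angle sum is what makes the
    prescribed [n]-th and [m]-th powers of the direction compatible, and coprimality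
    then gives the direction itself. *)
Lemma normal_root_exists n m x t r rho : coprime n m -> (m < n)%N ->
  0 < x -> 0 < r -> 0 < rho -> triangle_at n m x r rho ->
  cos (angle_sum n m x r rho) = (-1) ^+ n.+1 * cos (n%:R * t) ->
  exists z, normc z = rho /\ normal_root n m x t r z.
Proof.
move=> cop mn x0 r0 rho0 pqr.
rewrite /angle_sum.
set A := angle (rho ^+ n) _ r; set B := angle (x * rho ^+ m) _ r.
set F := n%:R * A + m%:R * B => cF.
have n0 : (0 < n)%N by apply: leq_ltn_trans mn.
pose s1 : R[i] := (-1) ^+ n.+1.
pose D := n%:R * t + ((n - m) * n.+1)%:R * pi.
have eD : expi D = s1 * expi (n%:R * t).
  rewrite expiD expi_natpi mulrC; congr (_ * _).
  have := congr1 (fun y : R => y%:C) (signr_coprime cop mn).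
  by rewrite !rmorphXn/= rmorphN1.
have cFD : cos F = cos D.
  rewrite cF; have := congr1 (@complex.Re R) eD.
  have -> : s1 = ((-1) ^+ n.+1 : R)%:C by rewrite rmorphXn/= rmorphN1.
  by rewrite /expi; simpc.
have [e eF] : exists e : bool, expi ((-1) ^+ e * F) = expi (- D).
  have [sFD|sFD] := sin_of_cos_eq cFD; [exists true|exists false].
    by rewrite expr1 mulN1r /expi !cosN !sinN cFD sFD.
  by rewrite expr0 mul1r /expi cosN sinN cFD sFD.
pose phi : R := (-1) ^+ e * B; pose psi : R := - ((-1) ^+ e * A).
have closed : (rho ^+ n)%:C * expi phi + (x * rho ^+ m)%:C * expi psi = r%:C.
  by apply: angles_close_triangle; rewrite ?mulr_gt0 ?exprn_gt0.
have epsi : expi (n%:R * (psi - t)) = s1 * expi (m%:R * phi).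
  have -> : n%:R * (psi - t) = - ((-1) ^+ e * F) + m%:R * phi - n%:R * t.
    by rewrite /psi /phi /F; ring.
  rewrite !expiD [expi (- ((-1) ^+ e * F))]expiN eF -expiN opprK eD.
  by rewrite expiN mulrAC mulfK// expi_neq0.
have s1_neq0 : s1 != 0 by rewrite signr_eq0.
have [|||w [wn wm]] :=
  @coprime_power_root _ (s1 * expi phi) (s1 * expi (psi - t)) n m n0 cop.
- by rewrite mulf_neq0 ?expi_neq0.
- by rewrite mulf_neq0 ?expi_neq0.
- rewrite !exprMn -!expiMn epsi [_ * (s1 * _)]mulrA -exprSr; congr (_ * _).
  have h : odd (n.+1 * m) = odd (n.+1 * n.+1).
    by rewrite !oddM /=; case: (odd n) (coprime_odd cop); case: (odd m).
  by rewrite /s1 -!exprM -signr_odd h signr_odd.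
have w1 : normc w = 1.
  have := congr1 (@ComplexField.Normc.normc R) wn.
  rewrite normcX ComplexField.Normc.normcM normc_expi mulr1.
  rewrite normcX -expi_pi normc_expi expr1n => /eqP.
  by rewrite pexpr_eq1 ?normc_ge0// => /eqP.
exists (rho%:C * w); split.
  by rewrite ComplexField.Normc.normcM w1 mulr1 normc_real gtr0_norm.
rewrite /normal_root !exprMn wn wm.
have -> : ((-1) ^+ n * r)%:C = - (s1 * r%:C) :> R[i].
  by rewrite rmorphM/= rmorphXn/= rmorphN1 /s1 exprS mulN1r mulNr opprK.
rewrite -closed expiD expiN rmorphM/= !rmorphXn/=.
by field; exact: expi_neq0.
Qed.

End Roots.

(** * Stability criteria *)

Section Stability.
Variable R : realType.
Implicit Types (x r t u v : R) (z b c : R[i]) (n m : nat).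
Local Notation normc := ComplexField.Normc.normc.

Lemma schur_stableE n m b c : schur_stable (trinomial n m b c) <->
  forall z, z ^+ n + b * z ^+ m + c = 0 -> normc z < 1.
Proof.
have eval z : (trinomial n m b c).[z] = z ^+ n + b * z ^+ m + c.
  by rewrite /trinomial !hornerE.
by split=> h z hz; apply: h; move: hz; rewrite /root eval => /eqP.
Qed.

Lemma cosDnatpi n t : cos (n%:R * pi + t) = (-1) ^+ n * cos t.
Proof.
have := congr1 (@complex.Re R) (expiD (n%:R * pi) t); rewrite expi_natpi.
have -> : (-1) ^+ n = ((-1) ^+ n : R)%:C :> R[i] by rewrite rmorphXn/= rmorphN1.
by rewrite /expi; simpc.
Qed.

Lemma signr_pred n : (0 < n)%N -> (-1) ^+ n.+1 = (-1) ^+ n.-1 :> R.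
Proof. by case: n => // n _; rewrite !exprS !mulN1r opprK. Qed.

Section Normalised.
Variables (n m : nat) (x r t : R).

Definition normalised_trinomial : {poly R[i]} :=
  trinomial n m (x%:C * expi t) ((-1) ^+ n * r)%:C.

(** The value [(n - 1) pi + n |t|] meets the root condition. If it were at least the
    angle sum at 1, it would be attained at some radius [rho >= 1] and yield a root of
    modulus [rho]. *)
Lemma angle_sum_gt_of_stable : coprime n m -> (m < n)%N -> 0 < x -> 0 < r ->
  n%:R * `|t| <= pi -> 1 <= x + r -> schur_stable normalised_trinomial ->
  n.-1%:R * pi + n%:R * `|t| < angle_sum n m x r 1.
Proof.
move=> cop mn x0 r0 tpi xr /schur_stableE stable.
rewrite ltNge; apply/negP => le.
have n0 : (0 < n)%N by apply: leq_ltn_trans mn.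
pose v := n.-1%:R * pi + n%:R * `|t|.
have [|rho [rho1 tri hv]] := @angle_sum_surjective _ n m x r v mn x0 r0 xr.
  rewrite le/= -[in leRHS](prednK n0) -natr1 mulrDl mul1r.
  by rewrite lerD2l.
have rho0 : 0 < rho by lra.
have [|z [zrho hz]] := normal_root_exists (t := t) cop mn x0 r0 rho0 tri.
  rewrite hv cosDnatpi -{1}[n%:R]normr_nat -normrM cos_norm.
  by rewrite signr_pred.
by have := stable z hz; rewrite zrho; lra.
Qed.

(** At a root of modulus at least 1 the angle sum is, by monotonicity, strictly above
    [(n - 1) pi + n |t|] and at most [n pi]; on that interval the cosine is
    injective, so the root condition fails. *)
Lemma stable_of_angle_sum_gt : coprime n m -> (m < n)%N -> 0 < x -> 0 < r ->
  triangle_at n m x r 1 ->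
  n.-1%:R * pi + n%:R * `|t| < angle_sum n m x r 1 ->
  schur_stable normalised_trinomial.
Proof.
move=> cop mn x0 r0 tri big; apply/schur_stableE => z hz.
rewrite ltNge; apply/negP => z1.
have n0 : (0 < n)%N by apply: leq_ltn_trans mn.
have z0 : z != 0 by rewrite -normc_eq0 gt_eqF//; lra.
have [triz cosz] := cos_angle_sum_of_root cop mn x0 r0 z0 hz.
set rho := normc z in z1 triz cosz.
have rho0 : 0 < rho by lra.
have nt0 : 0 <= n%:R * `|t| by rewrite mulr_ge0.
have mpi : m%:R * pi <= n.-1%:R * pi :> R.
  by rewrite ler_wpM2r ?pi_ge0// ler_nat -ltnS prednK.
have le1 : angle_sum n m x r 1 <= angle_sum n m x r rho.
  by apply: angle_sum_le => //; lra.
have le2 := angle_sum_le_pi x0 r0 (ltnW mn) rho0 triz.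
have npi : n%:R * pi = n.-1%:R * pi + pi :> R.
  by rewrite -{1}(prednK n0) -natr1 mulrDl mul1r.
pose g := angle_sum n m x r rho - n.-1%:R * pi.
have : cos g = cos (n%:R * `|t|).
  have : angle_sum n m x r rho = n.-1%:R * pi + g by rewrite /g; lra.
  move: cosz => /[swap] ->; rewrite cosDnatpi -{2}[n%:R]normr_nat -normrM cos_norm.
  rewrite signr_pred//.
  by move/mulfI; apply; rewrite signr_eq0.
move/cos_inj; rewrite !in_itv/= /g => h.
by have := h _ _; lra.
Qed.

(** A failing triangle inequality freezes the angle sum at [n pi], [m pi] or 0. The
    bound excludes the last two values, and [1 <= x + r] lets the first one occur
    only for a degenerate triangle. *)
Lemma triangle_at1_of_gt : (m < n)%N -> 0 < x -> 0 < r -> 1 <= x + r ->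
  n.-1%:R * pi < angle_sum n m x r 1 -> triangle_at n m x r 1.
Proof.
move=> mn x0 r0 xr big.
have n0 : (0 < n)%N by apply: leq_ltn_trans mn.
have mpi : m%:R * pi <= n.-1%:R * pi :> R.
  by rewrite ler_wpM2r ?pi_ge0// ler_nat -ltnS prednK.
have ppi : 0 <= n.-1%:R * pi :> R by rewrite mulr_ge0 ?pi_ge0.
have [//|h|h|h] := @triangle_atP _ n m _ _ 1 x0 r0 ltr01.
- by move: big; rewrite (angle_sum_second x0 r0 ltr01 h); lra.
- by move: h; rewrite /triangle_at !expr1n !mulr1 => h; split; lra.
- by move: big; rewrite (angle_sum_third x0 r0 ltr01 h); lra.
Qed.

End Normalised.

Lemma stable_of_small n m b c : (m <= n)%N -> normc b + normc c < 1 ->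
  schur_stable (trinomial n m b c).
Proof.
move=> mn small; apply/schur_stableE => z hz.
rewrite ltNge; apply/negP => z1.
have zm1 : 1 <= normc z ^+ m by rewrite exprn_ege1.
have zmn : normc z ^+ m <= normc z ^+ n by rewrite ler_weXn2l.
have : normc z ^+ n <= normc b * normc z ^+ m + normc c.
  have -> : normc z ^+ n = normc (b * z ^+ m + c).
    rewrite -normcX.
    have -> : z ^+ n = - (b * z ^+ m + c).
      by apply/eqP; rewrite -subr_eq0 opprK addrA; apply/eqP.
    by rewrite -mulN1r ComplexField.Normc.normcM -expi_pi normc_expi mul1r.
  by rewrite -normcX -ComplexField.Normc.normcM; exact: le_normcD.
have b0 := normc_ge0 b; have c0 := normc_ge0 c.
have := ler_peMr c0 zm1.
have : (normc b + normc c) * normc z ^+ m < normc z ^+ m.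
  by rewrite gtr_pMl//; lra.
by rewrite mulrDl; lra.
Qed.

Lemma nth_root_exists (w : R[i]) n : (0 < n)%N -> exists z, z ^+ n = w.
Proof. by move=> n0; exists (n.-root w)%C; rewrite rootCK. Qed.

(** With [b = 0] the roots are the [n]-th roots of [- c], and stability would bound
    the modulus of [c] by 1. *)
Lemma stable_middle_neq0 n m b c : (0 < n)%N ->
  schur_stable (trinomial n m b c) ->
  1 <= normc b + normc c -> b != 0.
Proof.
move=> n0 /schur_stableE st; apply: contraTN => /eqP b0.
rewrite -ltNge b0 ComplexField.Normc.normc0 add0r.
have [z zn] := nth_root_exists (- c) n0.
have := st z; rewrite zn b0 mul0r addr0 addNr => /(_ erefl) z1.
have -> : normc c = normc z ^+ n.
  by rewrite -normcX zn -mulN1r ComplexField.Normc.normcM -expi_pi normc_expi mul1r.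
by rewrite exprn_ilt1 ?normc_ge0// -lt0n.
Qed.

Lemma stable_constant_neq0 n m b c : (m < n)%N -> schur_stable (trinomial n m b c) ->
  1 <= normc b + normc c -> c != 0.
Proof.
move=> mn /schur_stableE st; apply: contraTN => /eqP c0.
rewrite -ltNge c0 ComplexField.Normc.normc0 addr0.
have nm0 : (0 < n - m)%N by rewrite subn_gt0.
have [z zn] := nth_root_exists (- b) nm0.
have := st z; rewrite c0 addr0 -(subnK (ltnW mn)) exprD zn mulNr addNr => /(_ erefl) z1.
have -> : normc b = normc z ^+ (n - m).
  by rewrite -normcX zn -mulN1r ComplexField.Normc.normcM -expi_pi normc_expi mul1r.
by rewrite exprn_ilt1 ?normc_ge0// -lt0n.
Qed.

End Stability.

(** * Normalisation by rotations *)

Section Normalisation.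
Variable R : realType.
Implicit Types (x r s t y : R) (z b c : R[i]) (n m : nat).
Local Notation normc := ComplexField.Normc.normc.

(** Multiplication by [expi s] maps the roots of the rotated trinomial to the roots of
    the given one. *)
Lemma rotate_stable n m b c s : (m <= n)%N -> schur_stable (trinomial n m b c) ->
  schur_stable (trinomial n m (b * expi (- ((n%:R - m%:R) * s)))
                              (c * expi (- (n%:R * s)))).
Proof.
move=> mn /schur_stableE st; apply/schur_stableE => z hz.
have := st (z * expi s).
rewrite ComplexField.Normc.normcM normc_expi mulr1; apply.
have e0 := expi_neq0 s.
rewrite -[RHS](mulr0 (expi s ^+ n)) -hz -natrB// !expiN !expiMn.
rewrite !exprMn (_ : expi s ^+ n = expi s ^+ (n - m) * expi s ^+ m); last first.
  by rewrite -exprD subnK.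
by field; rewrite !expf_neq0.
Qed.

Lemma rotate_stableE n m b c s : (m <= n)%N ->
  schur_stable (trinomial n m (b * expi (- ((n%:R - m%:R) * s)))
                              (c * expi (- (n%:R * s)))) <->
  schur_stable (trinomial n m b c).
Proof.
move=> mn; split=> [/(@rotate_stable _ _ _ _ (- s) mn)|]; last exact: rotate_stable.
by rewrite !mulrN !opprK -!mulrA -!expiD !addNr !expi0 !mulr1.
Qed.

Lemma reduce_mod2pi s : exists (s' : R) (k : int),
  0 <= s' <= 2 * pi /\ s = s' + 2 * pi * k%:~R.
Proof.
have pi2 : 0 < 2 * pi :> R by rewrite mulr_gt0// pi_gt0.
pose y := s / (2 * pi); pose k := Num.floor y.
exists (s - 2 * pi * k%:~R), k; split; last by rewrite subrK.
have sE : s = 2 * pi * y by rewrite /y mulrC divfK// gt_eqF.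
have /andP[ky yk] := floor_itv y; rewrite intrD in yk.
rewrite sE -mulrBr; apply/andP; split.
  by rewrite mulr_ge0 ?(ltW pi2)// subr_ge0.
by rewrite ler_piMr ?(ltW pi2)// lerBlDl ltW.
Qed.

(** The multiple of [2 * pi / n] nearest to [- t] is at distance at most [pi / n]. *)
Lemma nearest_multiple n t : (0 < n)%N ->
  exists k : int, n%:R * `|t + 2 * pi * k%:~R / n%:R| <= pi.
Proof.
move=> n0; have pi0 := pi_gt0 R.
have nR : 0 < n%:R :> R by rewrite ltr0n.
pose y := n%:R * t / (2 * pi); pose k := Num.floor (y + 2^-1).
exists (- k).
rewrite -{1}[n%:R]normr_nat -normrM.
have -> : n%:R * (t + 2 * pi * (- k)%:~R / n%:R) = 2 * pi * (y - k%:~R).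
  rewrite /y mulrNz; move: (@pi R) pi0 => p p0.
  by field; rewrite !gt_eqF.
rewrite normrM gtr0_norm ?mulr_gt0// -[leRHS]mulr1 [2 * pi]mulrC -mulrA ler_pM2l//.
have /andP[h1 h2] := floor_itv (y + 2^-1); rewrite intrD in h2.
have : `|y - k%:~R| <= 2^-1 by rewrite ler_norml; apply/andP; split; lra.
by lra.
Qed.

(** The phase of [c] fixes [s] up to multiples of [2 * pi / n]. Changing [s] by
    [2 * pi * j / n] changes the phase left for [t] by [2 * pi * (n - m) * j / n], and
    [n - m] is invertible modulo [n], so every shift of [t] by a multiple of
    [2 * pi / n] is available. *)
Lemma normalise n m b c : coprime n m -> (m < n)%N ->
  exists s t, [/\ 0 <= s <= 2 * pi, n%:R * `|t| <= pi,
    b = (normc b)%:C * expi t * expi (- ((n%:R - m%:R) * s)) &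
    c = ((-1) ^+ n * normc c)%:C * expi (- (n%:R * s))].
Proof.
move=> cop mn.
have n0 : (0 < n)%N by apply: leq_ltn_trans mn.
have nR : n%:R != 0 :> R by rewrite pnatr_eq0 -lt0n.
have [de bE] := polar b; have [ga cE] := polar c.
(* [sg] solves the equation for [c]; [s0] is the solution whose shift suits [t]. *)
pose sg := - (ga + n%:R * pi) / n%:R.
have [N hN] := nearest_multiple (de + (n%:R - m%:R) * sg) n0.
have nm0 : (0 < n - m)%N by rewrite subn_gt0.
case: (egcdnP n nm0) => a d; rewrite gcdnC.
have -> : gcdn n (n - m) = 1%N.
  rewrite -{1}(subnK (ltnW mn)) gcdnC gcdnDl -(eqP cop) gcdnC.
  by rewrite -{2}(subnKC (ltnW mn)) [RHS]gcdnC gcdnDl.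
move=> ad _.
have adR : a%:R * (n%:R - m%:R) = d%:R * n%:R + 1 :> R.
  by rewrite -(natrB R (ltnW mn)) -(natrM R a) ad (natrD R _ 1) (natrM R d).
pose s0 := sg + 2 * pi * (a%:Z * N)%:~R / n%:R.
have [s [k [s2pi s0E]]] := reduce_mod2pi s0.
exists s, (de + (n%:R - m%:R) * sg + 2 * pi * N%:~R / n%:R); split=> //.
- rewrite -mulrA -expiD {1}bE; congr (_ * _).
  rewrite -(expiD2piz de (- d%:Z * N + (n%:Z - m%:Z) * k)); congr expi.
  have -> : s = s0 - 2 * pi * k%:~R by rewrite s0E addrK.
  rewrite /s0 rmorphD/= !rmorphM/= rmorphB/= rmorphN/= -!pmulrn.
  have -> : d%:R = (a%:R * (n%:R - m%:R) - 1) / n%:R :> R.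
    by rewrite adR addrK mulfK.
  by field.
- rewrite {1}cE rmorphM/= rmorphXn/= rmorphN1.
  have -> : expi (- (n%:R * s)) = expi (ga + n%:R * pi).
    rewrite -(expiD2piz (ga + n%:R * pi) (- (a%:Z * N) + n%:Z * k)); congr expi.
    have -> : s = s0 - 2 * pi * k%:~R by rewrite s0E addrK.
    by rewrite /s0 /sg rmorphD/= rmorphN/= !rmorphM/= -!pmulrn; field.
  have ss : (-1) ^+ n * (-1) ^+ n = 1 :> R[i].
    by rewrite -exprMn mulrNN mulr1 expr1n.
  rewrite expiD expi_natpi -[LHS]mul1r -[X in X * _ = _]ss.
  by move: ((-1) ^+ n : R[i]) => e; ring.
Qed.

Lemma normalise_constant0 n m b : (m < n)%N ->
  exists s, 0 <= s <= 2 * pi /\ b = (normc b)%:C * expi (- ((n%:R - m%:R) * s)).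
Proof.
move=> mn; have [de bE] := polar b.
have nmR : n%:R - m%:R != 0 :> R by rewrite subr_eq0 eqr_nat gtn_eqF.
have [s [k [s2pi sE]]] := reduce_mod2pi (- de / (n%:R - m%:R)).
exists s; split=> //; rewrite {1}bE; congr (_ * _).
rewrite -(expiD2piz de ((n%:Z - m%:Z) * k)); congr expi.
have -> : s = - de / (n%:R - m%:R) - 2 * pi * k%:~R by rewrite sE addrK.
by rewrite rmorphM/= rmorphB/= -!pmulrn; field.
Qed.

End Normalisation.

(** * The parametrisation *)

Section StabilityRegion.
Variable R : realType.
Implicit Types (x r t u v y : R) (n m : nat).
Local Notation normc := ComplexField.Normc.normc.

(** The arguments of the arccosines in [omega] are the cosines of two angles of the
    triangle of sides 1, [u], [`|v|]. *)
Lemma acos_argsE u v : acos_arg1 u v = cos_law 1 u `|v| /\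
  acos_arg2 u v = cos_law u 1 `|v|.
Proof.
rewrite /acos_arg1 /acos_arg2 /cos_law !expr1n mulr1 real_normK ?num_real//.
by split=> //; rewrite addrAC.
Qed.

Lemma omega_args_triangle n m u v : 0 < u -> v != 0 ->
  triangle_at n m u `|v| 1 <->
  -1 <= acos_arg1 u v <= 1 /\ -1 <= acos_arg2 u v <= 1.
Proof.
move=> u0 v0; have nv0 : 0 < `|v| by rewrite normr_gt0.
have [-> ->] := acos_argsE u v.
rewrite /triangle_at !expr1n mulr1.
have h1 := cos_law_itv ltr01 u0 nv0; have h2 := cos_law_itv u0 ltr01 nv0.
split=> [tri|[/h1//]]; split; [exact/h1|apply/h2].
by case: tri => ? ? ?; split; lra.
Qed.

Lemma omegaE n m u v : 0 < u -> v != 0 -> triangle_at n m u `|v| 1 ->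
  2 * pi * omega n m u v = angle_sum n m u `|v| 1.
Proof.
move=> u0 v0; have nv0 : 0 < `|v| by rewrite normr_gt0.
rewrite /triangle_at /angle_sum !expr1n mulr1 => tri.
have tri' : triangle u 1 `|v| by case: tri => ? ? ?; split; lra.
rewrite !angleE// /omega; have [-> ->] := acos_argsE u v.
by rewrite mulrC divfK// gt_eqF// mulr_gt0// pi_gt0.
Qed.

(** The bound on [t] is the criterion of stability in terms of the angle sum at 1. *)
Lemma angle_bound_omega n m u v t : (0 < n)%N -> 0 < u -> v != 0 ->
  triangle_at n m u `|v| 1 ->
  (`|t| < pi * (2 * omega n m u v - n%:R + 1) / n%:R) =
  (n.-1%:R * pi + n%:R * `|t| < angle_sum n m u `|v| 1).
Proof.
move=> n0 u0 v0 tri; rewrite -(omegaE u0 v0 tri) ltr_pdivlMr ?ltr0n//.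
rewrite -subr_gt0 -[RHS]subr_gt0; congr (0 < _).
by rewrite -{2}(prednK n0) -natr1; ring.
Qed.

Lemma omega_condP n m u v : (0 < n)%N -> 0 < u -> v != 0 ->
  omega_cond n m u v <->
  triangle_at n m u `|v| 1 /\ n.-1%:R * pi < angle_sum n m u `|v| 1.
Proof.
move=> n0 u0 v0; have pi0 := pi_gt0 R.
have h (tri : triangle_at n m u `|v| 1) : (n%:R - 1 < 2 * omega n m u v) =
    (n.-1%:R * pi < angle_sum n m u `|v| 1).
  rewrite -(omegaE u0 v0 tri) [2 * pi]mulrC -mulrA [pi * _]mulrC ltr_pM2r//.
  by rewrite -{1}(prednK n0) -natr1 addrK.
split=> [[a1 a2 a3]|[tri a3]].
  have tri : triangle_at n m u `|v| 1 by apply/omega_args_triangle.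
  by split=> //; rewrite -h.
have [a1 a2] := (omega_args_triangle n m u0 v0).1 tri.
by split=> //; rewrite h.
Qed.

Lemma Delta_parityP n m x r :
  Delta_parity n m (point1 x ((-1) ^+ n * r)) <->
  [/\ 0 < x, 0 < r, 1 <= x + r & omega_cond n m x ((-1) ^+ n * r)].
Proof.
rewrite /Delta_parity -signr_odd; case: (odd n); rewrite ?expr1 ?expr0 ?mulN1r ?mul1r.
  split=> [[u [v [/point1_inj[<- <-] [? ? ? ?]]]]|[? ? ? ?]]; first by split=> //; lra.
  by exists x, (- r); split=> //; split=> //; lra.
split=> [[u [v [/point1_inj[<- <-] [? ? ? ?]]]]|[? ? ? ?]] //.
by exists x, r.
Qed.

Lemma normr_sign n r : 0 < r -> `|(-1) ^+ n * r| = r.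
Proof. by move=> r0; rewrite normrM normrX normrN1 expr1n mul1r gtr0_norm. Qed.

Lemma sign_neq0 n r : 0 < r -> (-1) ^+ n * r != 0.
Proof. by move=> r0; rewrite mulf_neq0 ?signr_eq0// gt_eqF. Qed.

End StabilityRegion.

Theorem theorem1p3 (R : realType) (n m : nat) :
  (1 <= m)%N -> (m < n)%N -> coprime n m ->
  (forall P : proj_plane R[i], Omega n m P ->
     exists x y s t : R, P = param_point n m x y s t /\ admissible n m x y s t)
  /\
  (forall x y s t : R, admissible n m x y s t ->
     Omega n m (param_point n m x y s t)).
Proof.
move=> _ mn cop.
have n0 : (0 < n)%N by apply: leq_ltn_trans mn.
have nR : 0 < n%:R :> R by rewrite ltr0n.
split=> [_ [b [c [-> st]]]|x y s t].
  have [c0|c0] := eqVneq c 0.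
    have [s [s2pi bE]] := normalise_constant0 b mn.
    exists (ComplexField.Normc.normc b), 0, s, 0; split.
      by rewrite /param_point expi0 mulr1 -bE c0 mul0r.
    split=> //.
    - exists (point1 b c); first by exists b, c.
      by rewrite Pi_map_point1 c0 ComplexField.Normc.normc0 mulr0.
    - by move=> _; rewrite normr0 divr_ge0 ?pi_ge0.
    - rewrite -(mulr0 ((-1) ^+ n)) => /Delta_parityP[_].
      by rewrite ltxx.
  have [s [t [s2pi tpi bE cE]]] := normalise b c cop mn.
  set x := ComplexField.Normc.normc b in bE; set r := ComplexField.Normc.normc c in cE.
  exists x, ((-1) ^+ n * r), s, t; split.
    by rewrite /param_point -bE -cE.
  split=> //.
  - by exists (point1 b c); [exists b, c|exact: Pi_map_point1].
  - by move=> _; rewrite ler_pdivlMr// mulrC.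
  - move=> /Delta_parityP[x0 r0 xr /omega_condP-/(_ n0 x0 (sign_neq0 n r0))[]].
    move=> tri _; rewrite angle_bound_omega ?sign_neq0// normr_sign//.
    apply: angle_sum_gt_of_stable => //.
    by move: st; rewrite bE cE => /(rotate_stableE _ _ _ (ltnW mn)).
move=> [[_ [b [c [-> st]]] /=]].
rewrite Pi_map_point1 => /point1_inj[xE yE] s2pi _ bound.
exists (x%:C * expi t * expi (- ((n%:R - m%:R) * s))), (y%:C * expi (- (n%:R * s))).
split=> //; apply/(rotate_stableE _ _ _ (ltnW mn)).
have [small|large] := ltP (ComplexField.Normc.normc b + ComplexField.Normc.normc c) 1.
  apply: stable_of_small (ltnW mn) _.
  rewrite ComplexField.Normc.normcM normc_expi mulr1 !normc_real -xE -yE.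
  rewrite normrM normrX normrN1 expr1n mul1r !ger0_norm// ?normc_ge0//.
have b0 := stable_middle_neq0 n0 st large.
have c0 := stable_constant_neq0 mn st large.
have [s' [t' [_ tpi bE cE]]] := normalise b c cop mn.
rewrite -yE in bound *; rewrite xE in bE large.
set r := ComplexField.Normc.normc c in bE cE large bound *.
have x0 : 0 < x by rewrite -xE lt_def normc_eq0 b0 normc_ge0.
have r0 : 0 < r by rewrite lt_def normc_eq0 c0 normc_ge0.
have gt' : n.-1%:R * pi + n%:R * `|t'| < angle_sum n m x r 1.
  apply: angle_sum_gt_of_stable => //.
  by move: st; rewrite bE cE => /(rotate_stableE _ _ _ (ltnW mn)).
have gt0 : n.-1%:R * pi < angle_sum n m x r 1.
  by apply: le_lt_trans gt'; rewrite lerDl mulr_ge0.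
have tri := triangle_at1_of_gt mn x0 r0 large gt0.
have yn0 := sign_neq0 n r0.
have Delta : Delta_parity n m (point1 x ((-1) ^+ n * r)).
  by apply/Delta_parityP; split=> //; apply/omega_condP; rewrite ?normr_sign.
apply: stable_of_angle_sum_gt => //.
by have := bound Delta; rewrite angle_bound_omega ?normr_sign.
Qed.
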